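(* Assume there exists a measurable cardinal. Then in every mean-payoff game with limited-observation $G$, either Eve has a winning observation-based strategy or Adam has a winning observation-based strategy.
   Context: A mean-payoff game (MPG) with partial-observation is a tuple $G=\langle Q,q_I,\Sigma,\Delta,w,Obs\rangle$ where $Q$ is a finite set of states, $q_I\in Q$, $\Sigma$ is a finite set of actions, $\Delta\subseteq Q\times\Sigma\times Q$ is total (for every $(q,\sigma)$ there is $q'$ with $(q,\sigma,q')\in\Delta$), $w:\Delta\to\mathbb{Z}$, and $Obs$ is a partition of $Q$. For $s\subseteq Q$, $\mathrm{post}_\sigma(s)=\{q':\exists q\in s,(q,\sigma,q')\in\Delta\}$. $G$ is an MPG with limited-observation if moreover $\{q_I\}\in Obs$ and for each $o\in Obs$, $\sigma\in\Sigma$, the set $\mathrm{post}_\sigma(o)$ is a union of elements of $Obs$. An abstract path is a sequence $o_0\sigma_0o_1\ldots$ with $o_i\in Obs$, $\sigma_i\in\Sigma$ such that for each $i$ there are $q\in o_i,q'\in o_{i+1}$ with $(q,\sigma_i,q')\in\Delta$; $\gamma(\psi)$ denotes the set of concrete paths $q_0\sigma_0q_1\ldots$ with $q_i\in o_i$ and $(q_i,\sigma_i,q_{i+1})\in\Delta$. A play is an infinite abstract path starting at the observation containing $q_I$; $\mathrm{Prefs}(G)$ is the set of its finite prefixes ending in an observation. For a concrete path $\pi$, $w(\pi[..n])=\sum_{i<n}w(q_i,\sigma_i,q_{i+1})$ and $\underline{MP}(\pi)=\liminf_{n}\frac1n w(\pi[..n])$. A play $\psi$ is winning for Eve if $\underline{MP}(\pi)\ge0$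 for all $\pi\in\gamma(\psi)$, and winning for Adam otherwise. An observation-based strategy for Eve is $\lambda_\exists:\mathrm{Prefs}(G)\to\Sigma$; a play is consistent with it if $\sigma_i=\lambda_\exists(o_0\sigma_0\ldots o_i)$ for all $i$. An observation-based strategy for Adam is $\lambda_\forall:\mathrm{Prefs}(G)\times\Sigma\to Obs$ with $\lambda_\forall(o_0\sigma_0\ldots o_n,\sigma)\cap\mathrm{post}_\sigma(o_n)\neq\emptyset$; a play is consistent with it if $\lambda_\forall(o_0\sigma_0\ldots o_i,\sigma_i)=o_{i+1}$ for all $i$. A strategy is winning for a player if every play consistent with it is winning for that player. *)

(* Defs.v *)
From HB Require Import structures.
From mathcomp Require Import all_boot all_order all_algebra.
From mathcomp Require Import all_classical all_reals all_analysis.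
From mathcomp Require Import Rstruct.
Set Implicit Arguments. Unset Strict Implicit. Unset Printing Implicit Defensive.
Import Order.TTheory GRing.Theory Num.Theory.

(* "|I| < |X|" is rendered as: there is no injection X -> I.           *)

Definition card_lt (I X : Type) : Prop := ~ exists f : X -> I, injective f.

Definition is_ultrafilter (X : Type) (U : (X -> Prop) -> Prop) : Prop :=
  [/\ U (fun _ => True),
      ~ U (fun _ => False),
      (forall A B : X -> Prop, U A -> (forall x, A x -> B x) -> U B),
      (forall A B : X -> Prop, U A -> U B -> U (fun x => A x /\ B x)) &
      (forall A : X -> Prop, U A \/ U (fun x => ~ A x))].

Definition nonprincipal (X : Type) (U : (X -> Prop) -> Prop) : Prop :=
  forall x : X, ~ U (fun y => y = x).

Definition kappa_complete (X : Type) (U : (X -> Prop) -> Prop) : Prop :=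
  forall (I : Type) (A : I -> X -> Prop), card_lt I X ->
    (forall i, U (A i)) -> U (fun x => forall i, A i x).

Definition measurable_cardinal_on (X : Type) : Prop :=
  card_lt nat X /\
  exists U : (X -> Prop) -> Prop,
    [/\ is_ultrafilter U, nonprincipal U & kappa_complete U].

Definition exists_measurable_cardinal : Prop :=
  exists X : Type, measurable_cardinal_on X.

(* Observations are the blocks (subsets of Q) of the partition Obs.    *)
(* The weight function is given on all triples; only its values on     *)
(* transitions in Delta are ever used.                                 *)

Record game := Game {
  St : finType;
  Act : finType;
  qI : St;
  Delta : St -> Act -> St -> bool;
  wt : St -> Act -> St -> int;
  Obs : {set {set St}}
}.

Section Game.
Variable G : game.

Definition post (a : Act G) (s : {set St G}) : {set St G} :=
  [set q' | [exists q in s, Delta q a q']].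

Definition is_mpg_po : Prop :=
  (forall (q : St G) (a : Act G), exists q', Delta q a q') /\
  finset.partition (Obs G) [set: St G].

Definition is_mpg_lo : Prop :=
  [/\ is_mpg_po,
      [set qI G] \in Obs G &
      forall o a, o \in Obs G ->
        exists2 S : {set {set St G}}, S \subset Obs G & post a o = finset.cover S].

Definition abstract_path (o : nat -> {set St G}) (a : nat -> Act G) : Prop :=
  forall i, o i \in Obs G /\
    exists q, exists q', [/\ q \in o i, q' \in o i.+1 & Delta q (a i) q'].

Definition init_obs (o : {set St G}) : Prop := o \in Obs G /\ qI G \in o.

Definition play (o : nat -> {set St G}) (a : nat -> Act G) : Prop :=
  init_obs (o 0%N) /\ abstract_path o a.

(* A finite prefix o_0 a_0 ... a_{n-1} o_n, represented as the list of
   pairs (o_i, a_i) for i < n together with the last observation o_n. *)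
Definition prefix_of (o : nat -> {set St G}) (a : nat -> Act G) (n : nat)
  : seq ({set St G} * Act G) * {set St G} :=
  ([seq (o i, a i) | i <- iota 0 n], o n).

Definition Prefs (p : seq ({set St G} * Act G) * {set St G}) : Prop :=
  exists o a n, play o a /\ prefix_of o a n = p.

Definition concretization (o : nat -> {set St G}) (a : nat -> Act G)
  (q : nat -> St G) : Prop :=
  forall i, q i \in o i /\ Delta (q i) (a i) (q i.+1).

Definition wsum (q : nat -> St G) (a : nat -> Act G) (n : nat) : int :=
  \sum_(i < n) wt (q i) (a i) (q i.+1).

Definition MP_inf (q : nat -> St G) (a : nat -> Act G) : \bar Rdefinitions.R :=
  limn_einf (fun n => (((wsum q a n)%:~R : Rdefinitions.R) / (n%:R : Rdefinitions.R))%:E).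

Definition winning_Eve (o : nat -> {set St G}) (a : nat -> Act G) : Prop :=
  forall q, concretization o a q -> (0 <= MP_inf q a)%E.

Definition winning_Adam (o : nat -> {set St G}) (a : nat -> Act G) : Prop :=
  ~ winning_Eve o a.

(* Observation-based strategies.  They are given as functions on all
   (list, observation) pairs; only their values on Prefs(G) matter. *)
Definition strat_Eve := seq ({set St G} * Act G) -> {set St G} -> Act G.
Definition strat_Adam :=
  seq ({set St G} * Act G) -> {set St G} -> Act G -> {set St G}.

Definition valid_Adam (l : strat_Adam) : Prop :=
  forall p, Prefs p -> forall a : Act G,
    l p.1 p.2 a \in Obs G /\ l p.1 p.2 a :&: post a p.2 != finset.set0.

Definition consistent_Eve (l : strat_Eve) o a : Prop :=
  forall i, a i = l (prefix_of o a i).1 (prefix_of o a i).2.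

Definition consistent_Adam (l : strat_Adam) o a : Prop :=
  forall i, l (prefix_of o a i).1 (prefix_of o a i).2 (a i) = o i.+1.

Definition winning_strat_Eve (l : strat_Eve) : Prop :=
  forall o a, play o a -> consistent_Eve l o a -> winning_Eve o a.

Definition winning_strat_Adam (l : strat_Adam) : Prop :=
  forall o a, play o a -> consistent_Adam l o a -> winning_Adam o a.

End Game.

(* Main.v *)
(* A play is won by Adam iff a tree of finite approximations (state path, times
   at which the average is below [-1/(k+1)], and [k]) has an infinite branch: an
   analytic condition.  Martin's argument applies.  In an auxiliary game Eve also
   names ranks in [X] that must embed the Kleene-Brouwer order of this tree in a
   well-founded order; Adam wins it as soon as the ranks are inconsistent, so it
   is determined.  If Eve wins it, forgetting the ranks wins the original game.
   If Adam wins it, he answers in the original game as he would for almost all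
   ranks, in the sense of the ultrafilter iterated along the Kleene-Brouwer order.
   Were such a play won by Eve, that order would be well-founded on the tree, and
   countable completeness would yield generic ranks contradicting his victory in
   the auxiliary game. *)
Require Import Defs.
From mathcomp Require Import all_boot all_order all_algebra.
From mathcomp Require Import all_classical all_reals all_analysis.
From mathcomp Require wochoice.
From mathcomp Require Import Rstruct zify.

Set Implicit Arguments.
Unset Strict Implicit.
Unset Printing Implicit Defensive.
Import Order.TTheory GRing.Theory Num.Theory.

(** * Ultrafilters *)

Lemma wf_strict_wo (T : eqType) (R : rel T) :
  wochoice.well_order R -> well_founded (fun x y => ~~ R y x).
Proof.
move=> wo x; apply: contrapT => nx.
have [|z [[/asboolP nz minz] _]] := wo [pred x | `[< ~ Acc (fun x y => ~~ R y x) x >]].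
  by exists x; apply/asboolP.
apply: nz; constructor => y ryz; apply: contrapT => ny.
by move: ryz; rewrite minz //; apply/asboolP.
Qed.

Lemma wo_refl (T : eqType) (R : rel T) : wochoice.well_order R -> reflexive R.
Proof.
move=> wo x; have [|z [[/eqP-> minz] _]] := wo (pred1 x); first by exists x; apply/eqP.
by apply: minz; apply/eqP.
Qed.

Lemma wo_anti (T : eqType) (R : rel T) : wochoice.well_order R -> antisymmetric R.
Proof.
move=> wo x y /andP[rxy ryx].
have [|z [_ uz]] := wo (pred2 x y); first by exists x; rewrite inE eqxx.
have rr := wo_refl wo.
have minx : wochoice.minimum_of R (pred2 x y) x.
  by split; [rewrite inE eqxx|move=> t /pred2P[]->].
have miny : wochoice.minimum_of R (pred2 x y) y.
  by split; [rewrite inE eqxx orbT|move=> t /pred2P[]->].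
by rewrite -(uz _ minx) -(uz _ miny).
Qed.

Definition countably_complete (X : Type) (U : (X -> Prop) -> Prop) : Prop :=
  forall A : nat -> X -> Prop, (forall n, U (A n)) -> U (fun x => forall n, A n x).

(* The order is that of the least initial segment [W] of measure one, with the
   points outside [W] placed below it. *)
Lemma measurable_ranking : exists_measurable_cardinal ->
  exists (X : Type) (U : (X -> Prop) -> Prop) (lt : X -> X -> Prop),
    [/\ is_ultrafilter U, countably_complete U, well_founded lt
      & forall x, U (lt x)].
Proof.
move=> [X [ncX [U [ufU npU kU]]]]; exists X, U.
have [R wo] := wochoice.well_ordering_principle {classic X}.
have rr := wo_refl wo; have ra := wo_anti wo; have rw := wf_strict_wo wo.
pose prec (x y : X) := ~~ R y x.
have [_ U0 US UI UC] := ufU.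
have cU : countably_complete U by move=> A UA; apply: kU.
have tail (x : X) : ~ U (fun y => prec y x) -> U (prec x).
  move=> nx; have [//|Ux] := UC (prec x).
  case: (UC (fun y => y = x)) => [/npU //|Unx]; case: nx.
  apply: US (UI _ _ Ux Unx) _ => y [/negP]; rewrite negbK => ryx nyx.
  by apply/negP => rxy; apply: nyx; apply: (ra y x); rewrite ryx.
suff [W [UW HW]] : exists W : X -> Prop, U W /\ forall x, W x -> U (prec x).
  exists (fun x y => W y /\ (W x -> prec x y)).
  split; [exact: ufU|exact: cU| |].
    move=> x; case: (pselect (W x)) => [Wx|nWx]; last by constructor => y [/nWx].
    elim: (rw x) Wx => {}x _ IH Wx; constructor => y [_ /= h].
    case: (pselect (W y)) => [Wy|nWy]; last by constructor => z [/nWy].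
    exact: IH (h Wy) Wy.
  move=> x; case: (pselect (W x)) => [Wx|nWx].
    by apply: US (UI _ _ UW (HW x Wx)) _ => y [].
  by apply: US UW _ => y.
(* If no proper initial segment has measure one, [W] is all of [X]; otherwise [W] lies below the
   least [x] whose segment has measure one. *)
case: (pselect (exists x, U (fun y => prec y x))) => [[x]|nx]; last first.
  exists (fun=> True); split=> [|x _]; first by have [] := ufU.
  by apply: tail => Ux; apply: nx; exists x.
elim: (rw x) => {}x _ IH Ux.
case: (pselect (exists2 y, prec y x & U (fun z => prec z y))) => [[y yx Uy]|ny].
  exact: IH yx Uy.
exists (fun y => prec y x); split=> // y yx; apply: tail => Uy.
by apply: ny; exists y.
Qed.

(** * The Kleene-Brouwer order *)

(** Extensions lie below their proper prefixes, so the finite initial segments of a branch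
    descend. *)
Fixpoint kb (s t : seq nat) : bool :=
  match s, t with
  | [::], _ => false
  | _ :: _, [::] => true
  | x :: s', y :: t' => (x < y) || (x == y) && kb s' t'
  end.

Lemma kb_irr s : kb s s = false.
Proof. by elim: s => //= x s ->; rewrite ltnn eqxx. Qed.

Lemma kb_trans : transitive kb.
Proof.
elim=> [|y t IH] [|x s] [|z u] //= /orP[xy|/andP[/eqP-> st]] /orP[yz|/andP[/eqP<- tu]].
- by rewrite (ltn_trans xy yz).
- by rewrite xy.
- by rewrite yz.
- by rewrite eqxx (IH _ _ st tu) orbT.
Qed.

Lemma kb_total s t : [|| s == t, kb s t | kb t s].
Proof.
elim: s t => [|x s IH] [|y t] //=; rewrite eqseq_cons.
by case: (ltngtP x y) => //= _; apply: IH.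
Qed.

Lemma kb_cat s t u : kb (s ++ t) (s ++ u) = kb t u.
Proof. by elim: s => //= x s ->; rewrite ltnn eqxx. Qed.

Lemma kb_catr s t u : ~~ prefix s t -> kb t (s ++ u) = kb t s.
Proof.
elim: s t => [|x s IH] [|y t] //=.
by case: (ltngtP x y) => //= _ /IH.
Qed.

Section KBWellFounded.
Variable T : seq nat -> Prop.
Hypothesis T_prefix : forall s u, T (s ++ u) -> T s.
Hypothesis no_branch : ~ exists y : nat -> nat, forall n, T (mkseq y n).

(** A non-accessible node has a non-accessible child in [T]; choosing such children from the root
    would build a branch. *)
Lemma wf_child_root : Acc (fun t s => T t /\ exists c, t = rcons s c) [::].
Proof.
set child := fun t s => _; apply: contrapT => nacc.
have next s : exists c, ~ Acc child s -> T (rcons s c) /\ ~ Acc child (rcons s c).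
  case: (pselect (Acc child s)) => [?|ns]; first by exists 0%N.
  apply: contrapT => nc; apply: ns; constructor => t [Tt [c def_t]]; subst t.
  by apply: contrapT => nt; apply: nc; exists c.
have [f fP] := choice next.
pose b n := iter n (fun s => rcons s (f s)) [::].
have bn n : ~ Acc child (b n) by elim: n => //= n /fP[].
apply: no_branch; exists (fun n => f (b n)) => n.
have <- : b n = mkseq (fun n => f (b n)) n.
  by elim: n => //= n IH; rewrite mkseqS -IH.
have [] := fP _ (bn n); rewrite -cats1 => + _; exact: T_prefix.
Qed.

Lemma kb_wf : well_founded (fun s t => [/\ T s, T t & kb s t]).
Proof.
set kbT := fun s t => _.
(* Induction on the subtree at [s]: once the nodes to its left are accessible, so are its proper
   extensions, child by child from left to right, and then [s], which comes last. *)
have sub s : Acc (fun t s => T t /\ exists c, t = rcons s c) s ->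
    (forall t, T t -> kb t s -> ~~ prefix s t -> Acc kbT t) ->
  forall t, T t -> prefix s t -> Acc kbT t.
  elim=> {}s _ IH left.
  have below c t : T t -> prefix (rcons s c) t -> Acc kbT t.
    elim/ltn_ind: c t => c IHc t Tt pt; apply: (IH (rcons s c)); [| |exact: Tt|exact: pt].
      by split; [case/prefixP: pt Tt => u -> /T_prefix | exists c].
    move=> {Tt pt}t Tt; rewrite -cats1.
    have [/prefixP[u def_t]|nst] := boolP (prefix s t); last first.
      by rewrite (kb_catr _ nst) => ? _; apply: left.
    subst t; rewrite kb_cat (prefix_catr _ _ (erefl _)).
    case: u Tt => [//|c' u] Tt /= /orP[lt_c _|/andP[/eqP-> _]].
      by apply: (IHc c'); rewrite // -cat_rcons prefix_prefix.
    by rewrite !eqxx prefix0s => /negP[].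
  have self : Acc kbT s.
    constructor => t [Tt Ts ts].
    have [pst|nst] := boolP (prefix s t); last exact: left.
    case/prefixP: pst Tt ts => [[|c u] ->]; first by rewrite cats0 kb_irr.
    by move=> Tt _; apply: (below c); rewrite // -cat_rcons prefix_prefix.
  move=> t Tt /prefixP[[|c u] def_t]; first by rewrite def_t cats0.
  by apply: (below c); rewrite // def_t -cat_rcons prefix_prefix.
move=> t; case: (pselect (T t)) => [Tt|nTt]; last by constructor => u [].
apply: (sub [::]); [exact: wf_child_root| |exact: Tt|exact: prefix0s].
by move=> u; rewrite prefix0s.
Qed.

End KBWellFounded.

(** * Iterated ultrafilter quantifiers *)

Section Generic.
Variables (X : Type) (U : (X -> Prop) -> Prop) (lt : X -> X -> Prop).
Hypothesis ufU : is_ultrafilter U.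
Hypothesis ccU : countably_complete U.
Hypothesis lt_ae : forall x, U (lt x).

Lemma ultra_sub (A B : X -> Prop) : U A -> (forall x, A x -> B x) -> U B.
Proof. by case: ufU => _ _ + _ _; apply. Qed.

Lemma ultra_all A : (forall x, A x) -> U A.
Proof. by case: ufU => UT _ US _ _ allA; apply: US UT _ => x _. Qed.

Lemma ultra_inhabited A : U A -> exists x, A x.
Proof.
move=> UA; apply: contrapT => nA; case: ufU => _ U0 _ _ _; apply: U0.
by apply: ultra_sub UA _ => x Ax; apply: nA; exists x.
Qed.

Lemma ultra_forall (I : countType) (A : I -> X -> Prop) :
  (forall i, U (A i)) -> U (fun x => forall i, A i x).
Proof.
move=> UA.
pose A' n x := if unpickle n is Some i then A i x else True.
have UA' n : U (A' n).
  by rewrite /A'; case: unpickle => [i|]; [exact: UA | exact: ultra_all].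
by apply: ultra_sub (ccU UA') _ => x Ax i; have := Ax (pickle i); rewrite /A' pickleK.
Qed.

Lemma ultra_and A B : U A -> U B -> U (fun x => A x /\ B x).
Proof. by case: ufU => _ _ _ + _; apply. Qed.

(** Otherwise [X] would be a countable union of null fibres. *)
Lemma ultra_const (B : countType) (f : X -> B) : exists b, U (fun x => f x = b).
Proof.
apply: contrapT => nb; have Un b : U (fun x => f x <> b).
  have [_ _ _ _ UC] := ufU; case: (UC (fun x => f x = b)) => // Ub.
  by case: nb; exists b.
by have [x /(_ (f x))] := ultra_inhabited (ultra_forall Un).
Qed.

Definition upd (e : nat -> X) i x : nat -> X := fun j => if j == i then x else e j.

(* [ultra_iter [:: i1; ..; im] Z e]: for U-almost all x1, .., for U-almost all
   xm, [Z] holds of [e] with each [ij] remapped to [xj]. *)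
Fixpoint ultra_iter (l : seq nat) (Z : (nat -> X) -> Prop) (e : nat -> X) : Prop :=
  if l is i :: l' then U (fun x => ultra_iter l' Z (upd e i x)) else Z e.

Lemma ultra_iter_const (B : countType) (f : (nat -> X) -> B) l e :
  exists b, ultra_iter l (fun e => f e = b) e.
Proof.
elim: l e => [|i l IH] e /=; first by exists (f e).
have [b bP] := choice (fun x => IH (upd e i x)).
by have [c Uc] := ultra_const b; exists c; apply: ultra_sub Uc _ => x <-.
Qed.

(** This is the environment reached by [ultra_iter] from the constant [d] once the quantifiers in
    [l] are instantiated by [g]. *)
Definition restr (d : X) (g : nat -> X) (l : seq nat) : nat -> X :=
  fun j => if j \in l then g j else d.

(* Along the well-founded [R] each value is chosen from a set of measure one
   given by the countably many constraints on the values chosen before. *)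
Lemma generic_assignment (d : X) (D : nat -> Prop) (R : nat -> nat -> Prop)
    (ls : nat -> seq nat) (Z : nat -> (nat -> X) -> Prop) :
  well_founded (fun j i => [/\ D j, D i & R j i]) ->
  (forall n i, i \in ls n -> D i) ->
  (forall n l i l', ls n = l ++ i :: l' -> forall j, j \in l -> R j i) ->
  (forall n, ultra_iter (ls n) (Z n) (fun=> d)) ->
  exists g : nat -> X,
    [/\ forall j i, D j -> D i -> R j i -> lt (g j) (g i),
        forall i, ~ D i -> g i = d
      & forall n, Z n (restr d g (ls n))].
Proof.
set R' := fun j i => _ => wfR lsD lsR UZ.
pose ok i g x := (forall j, R' j i -> lt (g j) x) /\
  forall n l l', ls n = l ++ i :: l' ->
    ultra_iter (i :: l') (Z n) (restr d g l) ->
    ultra_iter l' (Z n) (upd (restr d g l) i x).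
have okP (p : nat * (nat -> X)) : exists x, ok p.1 p.2 x.
  case: p => i g /=; apply: ultra_inhabited; apply: ultra_and.
    by apply: ultra_forall => j; apply: ultra_sub (lt_ae (g j)) _.
  have : U (fun x => forall t : nat * seq nat * seq nat, ls t.1.1 = t.1.2 ++ i :: t.2 ->
    ultra_iter (i :: t.2) (Z t.1.1) (restr d g t.1.2) ->
    ultra_iter t.2 (Z t.1.1) (upd (restr d g t.1.2) i x)).
    apply: ultra_forall => -[[n l] l'] /=.
    case: (pselect (ultra_iter (i :: l') (Z n) (restr d g l))) => [h|nh].
      by apply: ultra_sub h _ => x.
    exact: ultra_all.
  by move=> h; apply: ultra_sub h _ => x h n l l'; apply: (h (n, l, l')).
have [pk pkP] := choice okP.
(* The recursion knows only the values at predecessors of [i]; [d] fills the other places. *)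
pose below i (rec : forall j, R' j i -> X) j :=
  if pselect (R' j i) is left h then rec j h else d.
pose F i rec := if pselect (D i) then pk (i, below i rec) else d.
pose g := Fix wfR (fun=> X) F.
have gE i : g i = F i (fun j _ => g j).
  rewrite /g Fix_eq // => k f1 f2 ef; congr (F k).
  by apply: functional_extensionality_dep => j; apply: functional_extensionality_dep.
have okg i : D i -> ok i (below i (fun j _ => g j)) (g i).
  by move=> Di; rewrite gE /F; case: (pselect (D i)) => // ?; apply: (pkP (i, _)).
have belowE i j : R' j i -> below i (fun j _ => g j) j = g j.
  by rewrite /below; case: pselect.
exists g; split=> [j i Dj Di Rji|i nDi|n].
- have Rji' : R' j i by split.
  by have [/(_ j Rji') + _] := okg i Di; rewrite belowE.
- by rewrite gE /F; case: pselect.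
have partial l l' : ls n = l ++ l' -> ultra_iter l' (Z n) (restr d g l).
  elim/last_ind: l l' => [|l i IH] l' lsE.
    suff -> : restr d g [::] = fun=> d by rewrite -[l']/([::] ++ l') -lsE; apply: UZ.
    exact: funext.
  rewrite cat_rcons in lsE.
  have Di : D i by apply: (lsD n); rewrite lsE mem_cat mem_head orbT.
  have [_ /(_ n l l' lsE)] := okg i Di.
  (* By [lsR] the indices in [l] precede [i], so the recursion has their actual values. *)
  have -> : restr d (below i (fun j _ => g j)) l = restr d g l.
    apply: funext => j; rewrite /restr; case: ifP => // jl; apply: belowE.
    by split=> //; [apply: (lsD n); rewrite lsE mem_cat jl|apply: lsR lsE _ jl].
  move=> /(_ (IH _ lsE)); congr ultra_iter; apply: funext => j.
  by rewrite /upd /restr mem_rcons inE; case: eqP => [->|].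
by have := partial (ls n) [::]; rewrite cats0; apply.
Qed.

End Generic.

(** * Determinacy of games with an analytic payoff *)

(** Hence the first [n] rounds decide whether the [n]-th node is in the tree. *)
Lemma size_decode n : size (CodeSeq.decode n) <= n.
Proof.
rewrite -{2}[n]CodeSeq.decodeK; elim: (CodeSeq.decode n) => //= x s IH.
have := expn_gt0 2 x; nia.
Qed.

Section AnalyticDeterminacy.
Variables (A : Type) (B : countType) (a0 : A) (b0 : B).
Variable P : nat -> (nat -> A) -> (nat -> B) -> (nat -> nat) -> Prop.
Hypothesis P_local : forall n a a' b b' y y',
  (forall i, i < n -> [/\ a i = a' i, b i = b' i & y i = y' i]) ->
  P n a b y -> P n a' b' y'.

Definition analytic_payoff a b := exists y, forall n, P n a b y.

Definition history (a : nat -> A) (b : nat -> B) n := mkseq (fun i => (a i, b i)) n.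

Lemma historyS a b n : history a b n.+1 = rcons (history a b n) (a n, b n).
Proof. exact: mkseqS. Qed.

Lemma size_history a b n : size (history a b n) = n.
Proof. exact: size_mkseq. Qed.

Lemma mkseq_agree (T : Type) (f f' : nat -> T) n : mkseq f n = mkseq f' n ->
  forall i, i < n -> f i = f' i.
Proof.
elim: n => // n IH; rewrite !mkseqS => /rcons_inj[/IH{}IH fn] i.
by rewrite ltnS leq_eqVlt => /orP[/eqP->|/IH].
Qed.

Lemma history_agree a b a' b' n : history a b n = history a' b' n ->
  forall i, i < n -> a i = a' i /\ b i = b' i.
Proof. by move=> /mkseq_agree h i /h[-> ->]. Qed.

(** Quantifying over all [k] closes the tree under prefixes, as [P] need not be monotone in [n]; the
    padding by [0] is invisible by [P_local]. *)
Definition in_tree a b (s : seq nat) := forall k, k <= size s -> P k a b (nth 0 s).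

Lemma in_tree_local a b a' b' n s : size s <= n ->
  (forall i, i < n -> a i = a' i /\ b i = b' i) -> in_tree a b s -> in_tree a' b' s.
Proof.
move=> sn e h k ks; apply: P_local (h k ks) => i ik.
by have [|-> ->] := e i; first exact: leq_trans ik (leq_trans ks sn).
Qed.

Lemma in_tree_prefix a b s u : in_tree a b (s ++ u) -> in_tree a b s.
Proof.
move=> h k ks; apply: P_local (h k _) => [i ik|]; last by rewrite size_cat (leq_trans ks) ?leq_addr.
by rewrite nth_cat (leq_trans ik ks).
Qed.

Lemma branch_payoff a b y :
  (forall n, in_tree a b (mkseq y n)) -> analytic_payoff a b.
Proof.
move=> h; exists y => n; have := h n n; rewrite size_mkseq leqnn => /(_ isT).
by apply: P_local => i ilt; rewrite nth_mkseq.
Qed.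

Lemma payoff_branch a b : analytic_payoff a b ->
  exists y, forall n, in_tree a b (mkseq y n).
Proof.
move=> [y yP]; exists y => n k; rewrite size_mkseq => kn.
by apply: P_local (yP k) => i ik; rewrite nth_mkseq // (leq_trans ik kn).
Qed.

(** * The auxiliary game with ranks *)

Variables (X : Type) (U : (X -> Prop) -> Prop) (lt : X -> X -> Prop) (d : X).
Hypothesis ufU : is_ultrafilter U.
Hypothesis ccU : countably_complete U.
Hypothesis lt_wf : well_founded lt.
Hypothesis lt_ae : forall x, U (lt x).

Let node := CodeSeq.decode.

(* In the auxiliary game the first player also names in round [n] a rank [g n]
   for the [n]-th node; she loses once the ranks fail to embed the
   Kleene-Brouwer order of the tree of the play. *)
Definition rank_violation a b (g : nat -> X) := exists i j,
  [/\ in_tree a b (node i), in_tree a b (node j), kb (node j) (node i)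
    & ~ lt (g j) (g i)].

(** The ranks of the initial segments of a branch would descend forever in [lt]. *)
Lemma no_violation_no_payoff a b g : ~ rank_violation a b g -> ~ analytic_payoff a b.
Proof.
move=> nv /payoff_branch[y yP].
pose f n := g (CodeSeq.code (mkseq y n)).
have fS n : lt (f n.+1) (f n).
  apply: contrapT => nlt; apply: nv.
  exists (CodeSeq.code (mkseq y n)), (CodeSeq.code (mkseq y n.+1)).
  rewrite /node !CodeSeq.codeK; split=> //.
  by rewrite mkseqS -cats1 -{2}[mkseq y n]cats0 kb_cat.
suff : forall x, Acc lt x -> forall n, f n <> x by move/(_ _ (lt_wf (f 0)) 0).
by move=> x; elim=> {}x _ IH n fx; apply: (IH (f n.+1) _ n.+1); rewrite // -fx.
Qed.

Definition aux_strategy := seq (A * B) -> seq X -> A -> B.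

Definition follows (tau : aux_strategy) m a b g :=
  forall i, m <= i -> b i = tau (history a b i) (mkseq g i.+1) (a i).

Definition forces_violation (h : seq (A * B)) (es : seq X) :=
  exists tau, forall a b g, history a b (size h) = h -> mkseq g (size h) = es ->
    follows tau (size h) a b g -> rank_violation a b g.

Lemma forces_violation_step h es :
  (forall a x, exists b, forces_violation (rcons h (a, b)) (rcons es x)) ->
  forces_violation h es.
Proof.
move=> step.
have /choice[f fP] (p : A * X) : exists bt : B * aux_strategy,
    forall a b g, history a b (size h).+1 = rcons h (p.1, bt.1) ->
      mkseq g (size h).+1 = rcons es p.2 ->
      follows bt.2 (size h).+1 a b g -> rank_violation a b g.
  have [b [tau tauP]] := step p.1 p.2; exists (b, tau) => a b' g.
  by have := tauP a b' g; rewrite size_rcons.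
(* In later rounds the move and rank of round [size h] are reread from the history to select the
   continuation. *)
exists (fun h' es' a => if size h' == size h then (f (a, last d es')).1
  else (f ((nth (a0, b0) h' (size h)).1, nth d es' (size h))).2 h' es' a).
move=> a b g hE gE tauP.
have bE : b (size h) = (f (a (size h), g (size h))).1.
  by rewrite tauP // size_history eqxx mkseqS last_rcons.
apply: (fP (a (size h), g (size h))).
- by rewrite historyS hE /= -bE.
- by rewrite mkseqS gE.
move=> i hi; rewrite tauP ?(ltnW hi) // size_history gtn_eqF //.
by rewrite !nth_mkseq // ltnW.
Qed.

(** The violation condition is open: once both nodes are decided and both ranks named, every
    continuation wins. *)
Lemma forces_violation_now a b g : rank_violation a b g ->
  exists n, forces_violation (history a b n) (mkseq g n).
Proof.
move=> [i [j [Ti Tj kji nlt]]]; exists (maxn i j).+1, (fun _ _ _ => b0) => a' b' g'.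
rewrite size_history => hE gE _; exists i, j.
have im : i < (maxn i j).+1 by rewrite ltnS leq_maxl.
have jm : j < (maxn i j).+1 by rewrite ltnS leq_maxr.
have e k : k < (maxn i j).+1 -> a k = a' k /\ b k = b' k.
  by move=> km; have [-> ->] := history_agree hE km.
split=> //; last by rewrite !(mkseq_agree gE).
- by apply: in_tree_local e Ti; apply: leq_trans (size_decode _) (ltnW im).
- by apply: in_tree_local e Tj; apply: leq_trans (size_decode _) (ltnW jm).
Qed.

(** As in open determinacy, the first player can always avoid positions won by the opponent. Her
    ranks are recomputed from the history, so they can be hidden. *)
Lemma rank_strategy : ~ forces_violation [::] [::] ->
  exists sE : seq (A * B) -> A, forall a b,
    (forall i, a i = sE (history a b i)) -> ~ analytic_payoff a b.
Proof.
move=> nQ.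
have /choice[f fP] (p : seq (A * B) * seq X) : exists ax : A * X,
    ~ forces_violation p.1 p.2 ->
    forall b, ~ forces_violation (rcons p.1 (ax.1, b)) (rcons p.2 ax.2).
  case: (pselect (forces_violation p.1 p.2)) => [?|np]; first by exists (a0, d).
  apply: contrapT => nax; apply: np; apply: forces_violation_step => a x.
  by apply: contrapT => nb; apply: nax; exists (a, x) => _ b Qb; apply: nb; exists b.
pose st (h : seq (A * B)) := foldl (fun st ab => (rcons st.1 ab, rcons st.2 (f st).2))
  ([::], [::]) h.
exists (fun h => (f (st h)).1) => a b aE.
pose g n := (f (st (history a b n))).2.
have stE n : st (history a b n) = (history a b n, mkseq g n).
  elim: n => // n IH.
  by rewrite historyS mkseqS /st foldl_rcons -/(st _) {2}/g IH.
have nQn n : ~ forces_violation (history a b n) (mkseq g n).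
  elim: n => // n IH; rewrite historyS mkseqS.
  by have := fP (history a b n, mkseq g n) IH (b n); rewrite /= -stE -[(f _).1]aE.
by apply: (@no_violation_no_payoff _ _ g) => /forces_violation_now[n /nQn].
Qed.

(** * Integrating a strategy over the ranks *)

Definition kb_le i j := (i == j) || kb (node i) (node j).

Lemma kb_le_trans : transitive kb_le.
Proof.
move=> j i k /orP[/eqP-> //|ij] /orP[/eqP<-|jk]; first by rewrite /kb_le ij orbT.
by rewrite /kb_le (kb_trans ij jk) orbT.
Qed.

Lemma kb_le_total : total kb_le.
Proof.
move=> i j; have := kb_total (node i) (node j).
rewrite /kb_le (can_eq CodeSeq.decodeK) eq_sym.
by case: (j == i) => //= /orP[]->; rewrite ?orbT.
Qed.

(** These are the tree nodes whose ranks [tau] sees when answering after [h]; sorting makes the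
    iterated quantifiers follow the Kleene-Brouwer order. *)
Definition tree_nodes (h : seq (A * B)) : seq nat :=
  sort kb_le [seq i <- iota 0 (size h).+1 |
    `[< in_tree (fun i => (nth (a0, b0) h i).1) (fun i => (nth (a0, b0) h i).2) (node i) >]].

Lemma mem_tree_nodes a b n i :
  i \in tree_nodes (history a b n) <-> i <= n /\ in_tree a b (node i).
Proof.
rewrite mem_sort mem_filter mem_iota leq0n add0n /= ltnS size_history.
have e k : k < n -> (nth (a0, b0) (history a b n) k).1 = a k /\
                    (nth (a0, b0) (history a b n) k).2 = b k.
  by move=> kn; rewrite nth_mkseq.
split=> [/andP[/asboolP Ti le_in]|[le_in Ti]].
  by split=> //; apply: in_tree_local e Ti; apply: leq_trans (size_decode _) le_in.
rewrite le_in andbT; apply/asboolP.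
apply: in_tree_local Ti; first exact: leq_trans (size_decode _) le_in.
by move=> k /e[-> ->].
Qed.

Lemma tree_nodes_sorted h l i l' : tree_nodes h = l ++ i :: l' ->
  forall j, j \in l -> kb (node j) (node i).
Proof.
move=> lE j jl.
have : pairwise kb_le (tree_nodes h).
  by rewrite -(sorted_pairwise kb_le_trans); apply: sort_sorted kb_le_total _.
have : uniq (tree_nodes h) by rewrite sort_uniq filter_uniq // iota_uniq.
rewrite lE cat_uniq pairwise_cat => /and3P[_ /hasPn/(_ i) + _] /and3P[+ _ _].
rewrite mem_head => /(_ isT) /= il /allrelP/(_ j i jl); rewrite mem_head => /(_ isT).
by case/orP => // /eqP ji; rewrite -ji jl in il.
Qed.

(* Adam answers as [tau] does for almost all ranks; a play won by Eve would
   admit generic ranks, against which [tau] loses. *)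
Lemma integrated_strategy : forces_violation [::] [::] ->
  exists sA : seq (A * B) -> A -> B, forall a b,
    (forall i, b i = sA (history a b i) (a i)) -> analytic_payoff a b.
Proof.
move=> [tau tauP].
(* [B] is countable, so the answer is constant for almost all ranks of tree nodes, the other ranks
   being [d]. *)
have /choice[s sP] (p : seq (A * B) * A) := ultra_iter_const ufU ccU
  (fun e => tau p.1 (mkseq e (size p.1).+1) p.2) (tree_nodes p.1) (fun=> d).
exists (fun h a => s (h, a)) => a b bE; apply: contrapT => npay.
have wfT := kb_wf (@in_tree_prefix a b)
  (fun ex => let: ex_intro y yP := ex in npay (branch_payoff yP)).
have wfN : well_founded (fun j i =>
    [/\ in_tree a b (node j), in_tree a b (node i) & kb (node j) (node i)]).
  move=> i; move: {2}(node i) (erefl (node i)) => t it.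
  by elim: (wfT t) i it => {}t _ IH i it; constructor => j [Tj Ti kji];
    apply: (IH (node j)) => //; rewrite -it.
have [| | |g [mono outd gZ]] := generic_assignment ufU ccU lt_ae (d := d) wfN
  (ls := fun n => tree_nodes (history a b n))
  (Z := fun n e => tau (history a b n) (mkseq e n.+1) (a n) = b n).
- by move=> n i /mem_tree_nodes[].
- by move=> n; apply: tree_nodes_sorted.
- by move=> n; have := sP (history a b n, a n); rewrite -bE /= size_history.
have [|||i [j [Ti Tj kji]]] := tauP a b g; rewrite //; last by apply; apply: mono.
(* [restr] changes nothing here: an index up to [n] outside [tree_nodes] is off the tree, where [g]
   is already [d]. *)
move=> n _; rewrite -{1}gZ; congr (tau _ _ _).
apply/eq_in_map => i; rewrite mem_iota add0n ltnS => /= le_in; rewrite /restr.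
case: ifP => // ni; case: (pselect (in_tree a b (node i))) => [Ti|/outd->//].
by have/mem_tree_nodes : i <= n /\ in_tree a b (node i) by []; rewrite ni.
Qed.

Lemma analytic_determinacy :
  (exists sE : seq (A * B) -> A, forall a b,
    (forall i, a i = sE (history a b i)) -> ~ analytic_payoff a b) \/
  (exists sA : seq (A * B) -> A -> B, forall a b,
    (forall i, b i = sA (history a b i) (a i)) -> analytic_payoff a b).
Proof.
case: (pselect (forces_violation [::] [::])) => [/integrated_strategy|/rank_strategy].
  by right.
by left.
Qed.

End AnalyticDeterminacy.

(** * Mean-payoff games *)

(** The liminf is the supremum of the tail infima; quantifiers over naturals are what a branch can
    encode. *)
Lemma limn_einf_lt0P (R : realType) (u : nat -> R) :
  (~ (0 <= limn_einf (fun n => (u n)%:E))%E) <->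
  exists k, forall N, exists2 n, (N < n)%N & (u n <= - (k.+1%:R^-1))%R.
Proof.
rewrite limn_einf_lim (cvg_lim _ (@cvg_einfs_sup _ _)) //.
split=> [/negP|[k kP]]; last first.
  apply/negP; rewrite -ltNge.
  apply: (@le_lt_trans _ _ (- (k.+1%:R^-1))%:E); last first.
    by rewrite lte_fin oppr_lt0 invr_gt0 ltr0n.
  apply: ge_ereal_sup => _ [N _ <-]; have [n Nn un] := kP N.
  apply: (@le_trans _ _ (u n)%:E); last by rewrite lee_fin.
  by apply: ereal_inf_lbound; exists n => //=; apply: ltnW.
rewrite -ltNge => lt0.
have [k kP] : exists k,
    (ereal_sup (range (einfs (fun n => (u n)%:E))) < (- (k.+1%:R^-1 : R))%:E)%E.
  case: ereal_sup lt0 => [r|//|_]; last by exists 0%N; rewrite ltNyr.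
  rewrite lte_fin => r0; have r0' : (0 < - r)%R by rewrite oppr_gt0.
  (* This gives [k + 1 > 1 / (- r)], that is [r < - 1 / (k + 1)]. *)
  exists (Num.truncn (- r)^-1); rewrite lte_fin ltrNr.
  by rewrite invf_plt ?posrE ?ltr0n // truncnS_gt.
exists k => N; apply: contrapT => nn.
have : (einfs (fun n => (u n)%:E) N.+1 < (- (k.+1%:R^-1))%:E)%E.
  by apply: le_lt_trans kP; apply: ereal_sup_ubound; exists N.+1.
apply/negP; rewrite -leNgt; apply: le_ereal_inf_tmp => _ [n /= Nn <-].
rewrite lee_fin leNgt; apply/negP => un; apply: nn; exists n => //.
exact: ltW.
Qed.

Section MeanPayoff.
Variable G : game.

(** Adam's moves are the observations from time 1 on; limited observation makes the initial one a
    singleton. *)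
Definition obs_at (b : nat -> {set St G}) i : {set St G} :=
  if i is j.+1 then b j else finset.set1 (qI G).

Definition decode_witness (c : nat) : St G * nat * nat :=
  odflt (qI G, 0, 0) (unpickle c).

Definition average (q : nat -> St G) (a : nat -> Act G) n : Rdefinitions.R :=
  ((wsum q a n)%:~R / n%:R)%R.

(* [y i] encodes the state at time [i], a time after [i] at which the average is
   at most [-1/(k+1)], and [k] itself (read off [y 0]). *)
Definition adam_witness n (a : nat -> Act G) (b : nat -> {set St G}) (y : nat -> nat) :=
  let q i := (decode_witness (y i)).1.1 in
  let m i := (decode_witness (y i)).1.2 in
  let k := (decode_witness (y 0)).2 in
  forall i, i < n ->
    [/\ b i \in Obs G, q i \in obs_at b i, i.+1 < n -> Delta (q i) (a i) (q i.+1),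
        i < m i & m i < n -> (average q a (m i) <= - (k.+1%:R^-1))%R].

Lemma adam_witness_local n a a' b b' y y' :
  (forall i, i < n -> [/\ a i = a' i, b i = b' i & y i = y' i]) ->
  adam_witness n a b y -> adam_witness n a' b' y'.
Proof.
rewrite /adam_witness => e h /= i ilt; have [ea eb ey] := e i ilt; have [h1 h2 h3 h4 h5] := h i ilt.
have [_ _ ey0] := e 0 (leq_ltn_trans (leq0n i) ilt).
rewrite -ea -eb -ey -ey0; split=> //.
- by case: i ilt h2 {ea eb ey h1 h3 h4 h5} => //= j jlt; have [_ <- _] := e j (ltnW jlt).
- by move=> Sin; have [_ _ <-] := e _ Sin; apply: h3.
move=> mn; have <- : average (fun i => (decode_witness (y i)).1.1) a (decode_witness (y i)).1.2 =
    average (fun i => (decode_witness (y' i)).1.1) a' (decode_witness (y i)).1.2; last exact: h5.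
congr (_%:~R / _)%R; apply: eq_bigr => j _.
have jn := ltn_trans (ltn_ord j) mn; have [-> _ ->] := e _ jn.
by have [_ _ ->] := e _ (leq_ltn_trans (ltn_ord j) mn).
Qed.

(** The payoff absorbs the rules for Adam: an illegal answer leaves him without a concretization or
    outside [Obs]. *)
Lemma adam_payoffP a b :
  analytic_payoff adam_witness a b <->
  (forall i, b i \in Obs G) /\
  exists2 q, concretization (obs_at b) a q & ~ (0 <= MP_inf q a)%E.
Proof.
split=> [[y yP]|[bO [q qP /limn_einf_lt0P[k kP]]]].
  split=> [i|]; first by have [] := yP i.+1 i (ltnSn i).
  exists (fun i => (decode_witness (y i)).1.1).
    by move=> i; have [_ ? /(_ (ltnSn _)) ? _ _] := yP i.+2 i (ltnW (ltnSn _)).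
  apply/limn_einf_lt0P; exists (decode_witness (y 0)).2 => N.
  have [_ _ _ Nm _] := yP N.+1 N (ltnSn N).
  exists (decode_witness (y N)).1.2 => //.
  by have [_ _ _ _ /(_ (ltnSn _))] := yP (decode_witness (y N)).1.2.+1 N (leqW Nm).
have /choice[m mP] N : exists n, N < n /\ (average q a n <= - (k.+1%:R^-1))%R.
  by have [n ? ?] := kP N; exists n.
exists (fun i => pickle (q i, m i, k)) => n; rewrite /adam_witness /= => i ilt.
rewrite /decode_witness !pickleK /=; have [qo qD] := qP i; have [mi am] := mP i.
split=> // _; move: am; congr (average _ _ _ <= _)%R; apply: funext => j.
by rewrite pickleK.
Qed.

(** Regroups [o_0 a_0 ... o_n] into rounds [(a_i, o_{i+1})]. *)
Definition history_of_prefix (l : seq ({set St G} * Act G)) (o : {set St G}) :=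
  zip (unzip2 l) (behead (rcons (unzip1 l) o)).

Lemma history_of_prefixE o a n :
  history_of_prefix (prefix_of o a n).1 (prefix_of o a n).2 =
  history a (fun i => o i.+1) n.
Proof.
rewrite /history_of_prefix /= /unzip1 /unzip2 -!map_comp /comp /=.
rewrite -[[seq o i | i <- iota 0 n]]/(mkseq o n) -mkseqS /= -[iota 1 n]/(iota (1 + 0) n).
rewrite iotaDl -map_comp /history /mkseq.
by elim: (iota 0 n) => //= i s ->.
Qed.

Lemma obs_at_play o : is_mpg_lo G -> init_obs (o 0) -> obs_at (fun i => o i.+1) = o.
Proof.
move=> [[_ /and3P[_ /finset.trivIsetP tI _]] q0O _] [oO qo].
apply: funext => -[|i] //=; apply/eqP; apply: contraT => neq.
have /pred0P/(_ (qI G)) := tI _ _ q0O oO neq.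
by rewrite /= qo inE eqxx.
Qed.

Definition legal (o : {set St G}) (a : Act G) (o' : {set St G}) : bool :=
  (o' \in Obs G) && (o' :&: post a o != finset.set0).

Lemma legal_exists o a : is_mpg_po G -> o \in Obs G -> exists o', legal o a o'.
Proof.
move=> [tot /and3P[/eqP cO _ nO]] oO.
have /finset.set0Pn[q qo] : o != finset.set0 by apply: contra nO => /eqP<-.
have [q' qq'] := tot q a.
have : q' \in finset.cover (Obs G) by rewrite cO inE.
case/bigcupP => o' o'O q'o'; exists o'; rewrite /legal o'O.
apply/finset.set0Pn; exists q'; rewrite !inE q'o'; apply/existsP; exists q.
by rewrite qo.
Qed.

Lemma concretization_legal o a q : concretization o a q ->
  forall i, o i.+1 \in Obs G -> legal (o i) (a i) (o i.+1).
Proof.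
move=> qP i oO; rewrite /legal oO; have [qo qD] := qP i; have [q'o _] := qP i.+1.
apply/finset.set0Pn; exists (q i.+1); rewrite !inE q'o; apply/existsP; exists (q i).
by rewrite qo.
Qed.

Lemma mean_payoff_Eve sE : is_mpg_lo G ->
  (forall a b, (forall i, a i = sE (history a b i)) ->
     ~ analytic_payoff adam_witness a b) ->
  winning_strat_Eve (fun l o => sE (history_of_prefix l o)).
Proof.
move=> lo sEP o a [init oP] cons q qP; apply: contrapT => nMP.
apply: (sEP a (fun i => o i.+1)).
  by move=> i; rewrite [LHS]cons history_of_prefixE.
apply/adam_payoffP; split=> [i|]; first by have [] := oP i.+1.
by exists q; rewrite // obs_at_play.
Qed.

Fixpoint adam_history (sA : seq (Act G * {set St G}) -> Act G -> {set St G}) a n :=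
  if n is m.+1 then
    let h := adam_history sA a m in rcons h (a m, sA h (a m))
  else [::].

(* [sA] is only known to answer legally in the histories it generates, so its
   illegal answers are replaced by arbitrary legal ones. *)
Lemma mean_payoff_Adam sA : is_mpg_lo G ->
  (forall a b, (forall i, b i = sA (history a b i) (a i)) ->
     analytic_payoff adam_witness a b) ->
  exists lA : strat_Adam G, valid_Adam lA /\ winning_strat_Adam lA.
Proof.
move=> lo sAP; have [po _ _] := lo.
have /choice[dfl dflP] (p : {set St G} * Act G) :
    exists o', p.1 \in Obs G -> legal p.1 p.2 o'.
  have [oO|_] := boolP (p.1 \in Obs G); last by exists finset.set0.
  by have [c ?] := legal_exists p.2 po oO; exists c.
pose lA l o a := let o' := sA (history_of_prefix l o) a in
  if legal o a o' then o' else dfl (o, a).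
exists lA; split.
  move=> _ [ob [a' [n [[_ oP] <-]]]] a; rewrite /lA; apply/andP.
  case: ifP => // _; by apply: (dflP (ob n, a)); have [] := oP n.
move=> o a [init oP] cons winE.
pose b i := sA (adam_history sA a i) (a i).
have hE n : history a b n = adam_history sA a n.
  by elim: n => // n IH; rewrite historyS IH.
have /adam_payoffP[bO [q qP nMP]] : analytic_payoff adam_witness a b.
  by apply: sAP => i; rewrite hE.
(* The play [b] generated by [sA] has a concretization, so its answers are legal and [lA] never
   replaces one. *)
have oE i : o i.+1 = b i.
  elim/ltn_ind: i => i IH; rewrite -cons /lA history_of_prefixE.
  have -> : history a (fun i => o i.+1) i = history a b i.
    by apply/eq_in_map => j; rewrite mem_iota => /IH ->.
  have eo : o i = obs_at b i.
    by rewrite -(obs_at_play lo init); case: (i) IH => //= j ->.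
  have leg : legal (obs_at b i) (a i) (b i) := concretization_legal qP (i := i) (bO i).
  by rewrite hE /= -/(b i) eo leg.
apply: nMP; apply: winE => i; have [] := qP i.
by rewrite -(obs_at_play lo init); case: i => //= i; rewrite oE.
Qed.

End MeanPayoff.

Theorem theorem2 :
  exists_measurable_cardinal ->
  forall G : game, is_mpg_lo G ->
    (exists lE : strat_Eve G, winning_strat_Eve lE) \/
    (exists lA : strat_Adam G, valid_Adam lA /\ winning_strat_Adam lA).
Proof.
move=> /measurable_ranking[X [U [lt [ufU ccU lt_wf lt_ae]]]] G lo.
have [d _] : exists x : X, True by apply: (ultra_inhabited ufU); case: ufU.
case: (pickP (@predT (Act G))) => [a0 _|noact].
  have [[sE sEP]|[sA sAP]] := analytic_determinacy a0 (finset.set0 : {set St G})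
    (@adam_witness_local G) d ufU ccU lt_wf lt_ae.
    by left; exists (fun l o => sE (history_of_prefix l o)); apply: mean_payoff_Eve.
  by right; apply: mean_payoff_Adam sAP.
(* Without actions there are no plays, so any strategy of Adam wins vacuously. *)
right; exists (fun _ _ _ => finset.set0).
by split=> [p _ a|o a]; [have := noact a|have := noact (a 0)].
Qed.
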